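(* There is a $\mathcal{B}c^\circ$-formula $\varphi$ which is satisfiable over $\mathrm{RC}(\mathbb{R}^2)$, but which is not satisfied by any interpretation over $\mathrm{RC}(\mathbb{R}^2)$ in which every variable is assigned a region with finitely many connected components.
   Context: For a topological space $T$ and $X\subseteq T$, $\overline{X}$ is the closure and $X^\circ$ the interior of $X$; $X$ is regular closed if $X=\overline{X^\circ}$. $\mathrm{RC}(T)$ is the set of regular closed subsets of $T$ (''regions''); it is a Boolean algebra with $X+Y=X\cup Y$, $X\cdot Y=\overline{(X\cap Y)^\circ}$, $-X=\overline{T\setminus X}$, $0=\emptyset$, $1=T$. Terms are built from countably many variables $r_1,r_2,\dots$ and the constants $0,1$ using $+,\cdot,-$. $\mathcal{B}c^\circ$-formulas are built from atomic formulas $\tau_1=\tau_2$ and $c^\circ(\tau)$ using $\wedge$ and $\neg$ (there is no contact predicate). An interpretation $\mathfrak I$ over $\mathrm{RC}(T)$ assigns to each variable an element of $\mathrm{RC}(T)$ and is extended to terms via the Boolean operations; $\mathfrak I\models\tau_1=\tau_2$ iff $\tau_1^{\mathfrak I}=\tau_2^{\mathfrak I}$; $\mathfrak I\models c^\circ(\tau)$ iff the interior $(\tau^{\mathfrak I})^\circ$ is connected; connectives as usual. A formula is satisfiable over $\mathrm{RC}(T)$ if some interpretation over $\mathrm{RC}(T)$ satisfies it. *)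

(* Defs.v *)
From HB Require Import structures.
From mathcomp Require Import all_boot all_order all_algebra.
From mathcomp Require Import mathcomp_extra boolp classical_sets functions.
From mathcomp Require Import cardinality reals topology normedtype.

Set Implicit Arguments.
Unset Strict Implicit.
Unset Printing Implicit Defensive.
Import Order.TTheory GRing.Theory Num.Theory.
Import numFieldNormedType.Exports.
Local Open Scope classical_set_scope.

(* [TVar n] is the variable r_(n+1). *)
Inductive term : Type :=
| TVar of nat
| TZero
| TOne
| TAdd of term & term
| TMul of term & term
| TOpp of term.

(* The language Bc°: Boolean region terms, equality and the predicate c°
   ("the interior is connected"); there is no contact predicate. *)
Inductive formula : Type :=
| FEq of term & term
| FIntConn of term
| FAnd of formula & formula
| FNot of formula.

Section Semantics.
Variable T : topologicalType.

Definition RC : set (set T) := [set X | regclosed X].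

Definition rc_add (X Y : set T) : set T := X `|` Y.
Definition rc_mul (X Y : set T) : set T := closure (X `&` Y)°.
Definition rc_opp (X : set T) : set T := closure (~` X).

Definition interpretation_over_RC (I : nat -> set T) : Prop :=
  forall n, RC (I n).

Fixpoint term_val (I : nat -> set T) (t : term) : set T :=
  match t with
  | TVar n => I n
  | TZero => set0
  | TOne => setT
  | TAdd t1 t2 => rc_add (term_val I t1) (term_val I t2)
  | TMul t1 t2 => rc_mul (term_val I t1) (term_val I t2)
  | TOpp t1 => rc_opp (term_val I t1)
  end.

(* [connected] holds of the empty set, so c°(0) is true. *)
Fixpoint satisfies (I : nat -> set T) (phi : formula) : Prop :=
  match phi with
  | FEq t1 t2 => term_val I t1 = term_val I t2
  | FIntConn t => connected (term_val I t)°
  | FAnd phi1 phi2 => satisfies I phi1 /\ satisfies I phi2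
  | FNot phi1 => ~ satisfies I phi1
  end.

Definition satisfiable_over_RC (phi : formula) : Prop :=
  exists I : nat -> set T, interpretation_over_RC I /\ satisfies I phi.

Definition connected_components (X : set T) : set (set T) :=
  [set connected_component X x | x in X].

Definition finitely_many_components (X : set T) : Prop :=
  finite_set (connected_components X).

Lemma regclosed_closed (X : set T) : regclosed X -> closed X.
Proof. by move=> <-; exact: closed_closure. Qed.

Lemma term_val_RC (I : nat -> set T) (t : term) :
  interpretation_over_RC I -> RC (term_val I t).
Proof.
move=> IRC; elim: t => [n|||t1 R1 t2 R2|t1 _ t2 _|t R] /=.
- exact: IRC.
- by rewrite /RC /= /regclosed interior0 closure0.
- by rewrite /RC /= /regclosed interiorT closureT.
- rewrite /RC /= /regclosed eqEsubset; split.
    have cl : closed (rc_add (term_val I t1) (term_val I t2)).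
      by apply: closedU; exact: regclosed_closed.
    rewrite [X in _ `<=` X](iffLR (closure_id _) cl).
    by apply: closureS; exact: interior_subset.
  rewrite /rc_add -[X in X `|` _ `<=` _]R1 -[X in _ `|` X `<=` _]R2 -closureU.
  by apply: closureS; exact: interiorU.
- exact/closure_open_regclosed/open_interior.
- apply/closure_open_regclosed/closed_openC.
  exact: regclosed_closed.
Qed.

End Semantics.

Arguments RC : clear implicits.
Arguments satisfiable_over_RC : clear implicits.

(* Main.v *)
Require Import Defs.
From HB Require Import structures.
From mathcomp Require Import all_boot all_order all_algebra.
From mathcomp Require Import mathcomp_extra boolp classical_sets functions.
From mathcomp Require Import cardinality reals topology normedtype.
From mathcomp Require Import interval_inference convex sequences ring lra.
Import numFieldNormedType.Exports.

(** With the notation of [strip_configuration]: in the plane the components of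
    [t 0] and [t 1] can be vertical strips running from [b] up to [a], which
    alternate and accumulate at the left side of [z].

    In every configuration, [z] meets [t 0 + t 1] inside the interior of
    [z + t 0 + t 1], but meets neither [b + t 0] inside the interior of
    [b + t 0 + z] nor [b + t 1] inside the interior of [b + t 1 + z].  This
    forces a point [p] common to [z], [t 0] and [t 1].  If [t 0] and [t 1] had
    finitely many components, those through [p] would contain interior points
    of [t 0] and [t 1].  Joining [p], a point of [a] and a point of [b] to these
    points and to a point of [z] draws the graph K_{3,3} in the plane in such a
    way that independent edges are disjoint, which the Hanani-Tutte parity
    argument forbids. *)

Set Implicit Arguments.
Unset Strict Implicit.
Unset Printing Implicit Defensive.
Import Order.TTheory GRing.Theory Num.Theory.
Local Open Scope classical_set_scope.
Local Open Scope ring_scope.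

(** * Parities over pairs of indices *)

Lemma big_addb_const (I : finType) (P : pred I) (b : bool) :
  \big[addb/false]_(i | P i) b = b && odd #|P|.
Proof.
rewrite big_const; elim: #|_| => [|n /= ->]; first by rewrite andbF.
by case: b; rewrite ?addTb.
Qed.

Lemma big_addb_neq_fst (I : finType) (f : I -> bool) : odd #|I| ->
  \big[addb/false]_(p : I * I | p.1 != p.2) f p.1 = false.
Proof.
move=> oddI.
rewrite -(pair_big_dep xpredT (fun i j => i != j) (fun i _ => f i)) /=.
apply: big1 => i _; rewrite big_addb_const.
have -> : #|(fun j => i != j) : pred I| = #|I|.-1.
  by rewrite -(cardC1 i); apply: eq_card => j; rewrite !inE eq_sym.
by case: #|I| oddI => [//|n] /= /negbTE ->; rewrite andbF.
Qed.

Lemma big_addb_neq_swap (I : finType) (g : I -> I -> bool) :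
  \big[addb/false]_(p : I * I | p.1 != p.2) g p.2 p.1 =
  \big[addb/false]_(p : I * I | p.1 != p.2) g p.1 p.2.
Proof.
rewrite (reindex_inj (h := fun p => (p.2, p.1))) /=.
  by apply: eq_bigl => p; rewrite eq_sym.
by move=> [? ?] [? ?] [-> ->].
Qed.

Lemma big_addb_neq_snd (I : finType) (f : I -> bool) : odd #|I| ->
  \big[addb/false]_(p : I * I | p.1 != p.2) f p.2 = false.
Proof.
by move=> oddI; rewrite (big_addb_neq_swap (fun i _ => f i)) big_addb_neq_fst.
Qed.

Lemma big_addb_lt n (g : 'I_n -> 'I_n -> bool) :
  \big[addb/false]_(p : 'I_n * 'I_n | (p.1 < p.2)%N) (g p.1 p.2 (+) g p.2 p.1) =
  \big[addb/false]_(p : 'I_n * 'I_n | p.1 != p.2) g p.1 p.2.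
Proof.
rewrite [RHS](bigID (fun p : 'I_n * 'I_n => (p.1 < p.2)%N)) big_split /=.
congr addb; first by apply: eq_bigl => p; rewrite ltn_neqAle andbA andbb.
rewrite [RHS](reindex_inj (h := fun p => (p.2, p.1))) /=.
  by apply: eq_bigl => p; rewrite -leqNgt ltn_neqAle eq_sym.
by move=> [? ?] [? ?] [-> ->].
Qed.

Lemma big_addb_lt3_true :
  \big[addb/false]_(p : 'I_3 * 'I_3 | (p.1 < p.2)%N) true = true.
Proof.
rewrite -(pair_big_dep xpredT (fun i j : 'I_3 => (i < j)%N) (fun _ _ => true)).
rewrite !big_ord_recl big_ord0.
by do ![rewrite big_mkcond !big_ord_recl big_ord0 /=].
Qed.

(* Each crossing parity [N i j k] or [M i j l] and each comparison [A i k],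
   [D j k] or [C i l] is counted an even number of times, while every unordered
   pair [j != l] contributes [B j l (+) B l j = true]. *)
Lemma K33_parity (N M : 'I_3 -> 'I_3 -> 'I_3 -> bool)
    (A B C D : 'I_3 -> 'I_3 -> bool) :
  (forall j l, j != l -> B l j = ~~ B j l) ->
  ~ (forall i j k l : 'I_3, (i < k)%N -> j != l ->
       N i j k (+) M i j l (+) (N k l i (+) M k l j) =
       A i k (+) D j k (+) (C i l (+) B j l)).
Proof.
move=> BN eqNM; have odd3 : odd #|'I_3| by rewrite card_ord.
pose sumM i := \big[addb/false]_(q : 'I_3 * 'I_3 | q.1 != q.2) M i q.1 q.2.
suff : false = true by [].
transitivity (\big[addb/false]_(p : 'I_3 * 'I_3 | (p.1 < p.2)%N)
    \big[addb/false]_(q : 'I_3 * 'I_3 | q.1 != q.2)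
      (N p.1 q.1 p.2 (+) M p.1 q.1 q.2 (+) (N p.2 q.2 p.1 (+) M p.2 q.2 q.1))).
- transitivity (\big[addb/false]_(p : 'I_3 * 'I_3 | (p.1 < p.2)%N)
    (sumM p.1 (+) sumM p.2)).
    by rewrite (big_addb_lt (fun i _ => sumM i)) big_addb_neq_fst.
  apply: eq_bigr => p _.
  rewrite !big_split (big_addb_neq_fst (fun j => N p.1 j p.2)) //.
  rewrite (big_addb_neq_snd (fun l => N p.2 l p.1)) //.
  by rewrite (big_addb_neq_swap (M p.2)).
- rewrite -big_addb_lt3_true; apply: eq_bigr => p ltp.
  under eq_bigr => q neq do rewrite eqNM //.
  rewrite !big_split (big_addb_neq_fst (fun _ => A p.1 p.2)) //.
  rewrite (big_addb_neq_fst (fun j => D j p.2)) //.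
  rewrite (big_addb_neq_snd (C p.1)) //.
  rewrite -big_addb_lt -[RHS]big_addb_lt3_true.
  by apply: eq_bigr => q ltq; rewrite (BN q.1 q.2) ?neq_ltn ?ltq // addbN addbb.
Qed.

(** * Segments and polylines *)

Section Segment.
Variables (R : numDomainType) (V : lmodType R).
Implicit Types (x y q : V) (s : seq V).

Definition seg x y : set V := [set (1 - t) *: x + t *: y | t in `[0, 1]].

Fixpoint polyline x s : set V :=
  if s is y :: s' then seg x y `|` polyline y s' else [set x].

Definition edges x s : seq (V * V) := pairmap pair x s.

Lemma seg_left x y : seg x y x.
Proof.
exists 0; first by rewrite /= in_itv /= lexx ler01.
by rewrite subr0 scale1r scale0r addr0.
Qed.

Lemma seg_right x y : seg x y y.
Proof.
exists 1; first by rewrite /= in_itv /= lexx ler01.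
by rewrite subrr scale1r scale0r add0r.
Qed.

Lemma seg_sym x y : seg x y = seg y x.
Proof.
suff sub a b : seg a b `<=` seg b a by apply/seteqP; split; exact: sub.
move=> _ [t /= /[!in_itv] /= /andP[t0 t1] <-]; exists (1 - t).
  by rewrite /= in_itv /= subr_ge0 t1 gerBl.
by rewrite subKr addrC.
Qed.

Lemma convex_seg_sub (A : set V) x y :
  @convex_set R V A -> A x -> A y -> seg x y `<=` A.
Proof.
move=> cA Ax Ay _ [t /= /[!in_itv] /= /andP[t0 t1] <-].
have /set_mem := cA y x (Itv01 t0 t1) (mem_set Ay) (mem_set Ax).
by rewrite [_ + _]addrC.
Qed.

Lemma polyline_last x s : polyline x s (last x s).
Proof. by elim: s x => //= y s IH x; right; exact: IH. Qed.

Lemma polyline_rcons x s y :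
  polyline x (rcons s y) = polyline x s `|` seg (last x s) y.
Proof.
elim: s x => [|z s IH] x /=; last by rewrite IH setUA.
have -> : seg x y `|` [set y] = seg x y.
  by apply/setUidPl => _ ->; exact: seg_right.
by apply/esym/setUidPr => _ ->; exact: seg_left.
Qed.

Lemma edge_sub_polyline x s e :
  e \in edges x s -> seg e.1 e.2 `<=` polyline x s.
Proof.
elim: s x => // y s IH x; rewrite in_cons => /predU1P[->|/IH eys] q.
  by left.
by move=> /eys; right.
Qed.

Lemma mem_edges x s e :
  e \in edges x s -> (e.1 \in x :: s) && (e.2 \in x :: s).
Proof.
elim: s x => // y s IH x; rewrite in_cons => /predU1P[->|/IH /andP[]] /=.
  by rewrite mem_head in_cons mem_head orbT.
by rewrite ![_ \in x :: _]in_cons => -> ->; rewrite !orbT.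
Qed.

Lemma big_addb_edges (f : V -> bool) x s :
  \big[addb/false]_(e <- edges x s) (f e.1 (+) f e.2) = f x (+) f (last x s).
Proof.
elim: s x => [|y s IH] x; first by rewrite big_nil addbb.
by rewrite big_cons IH addbA addbK.
Qed.

End Segment.

Section LinearImage.
Variables (R : numDomainType) (V W : lmodType R) (f : {linear V -> W}).

Lemma seg_image x y : seg (f x) (f y) = f @` seg x y.
Proof.
by rewrite image_comp; apply: eq_imagel => t _ /=; rewrite linearD !linearZ.
Qed.

Lemma polyline_image x s : polyline (f x) (map f s) = f @` polyline x s.
Proof.
elim: s x => [|y s IH] x /=; first by rewrite image_set1.
by rewrite seg_image IH image_setU.
Qed.

End LinearImage.

Section Reachability.
Variables (R : numDomainType) (V : tvsType R).
Implicit Types (x y q : V) (O C : set V).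

Definition polyline_joined O x y :=
  exists s, last x s = y /\ polyline x s `<=` O.

Lemma polyline_joined_seg O x y z :
  polyline_joined O x y -> seg y z `<=` O -> polyline_joined O x z.
Proof.
move=> [s [sy sO]] yz; exists (rcons s z); split; first by rewrite last_rcons.
by rewrite polyline_rcons sy subUset.
Qed.

Lemma nbhs_seg_sub O q : open O -> O q -> \forall y \near q, seg q y `<=` O.
Proof.
move=> oO Oq; have [B convexB [openB basisB]] := @locally_convex R V.
have [U [BU Uq] UO] := basisB q O (open_nbhs_nbhs (conj oO Oq)).
have := open_nbhs_nbhs (conj (openB U BU) Uq); apply: filterS => y Uy.
by apply: subset_trans UO; apply: convex_seg_sub Uq Uy; exact/convexB/mem_set.
Qed.

(* The points of [O] joined to [x] form a relatively clopen subset of [O]. *)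
Lemma connected_polyline_joined O C x y :
  open O -> C `<=` O -> connected C -> C x -> C y -> polyline_joined O x y.
Proof.
move=> oO CO cC Cx Cy; pose P := [set q | polyline_joined O x q].
have PO : P `<=` O by move=> _ [s [<- sO]]; exact/sO/polyline_last.
have oP : open P.
  rewrite openE => q Pq; apply: filterS (nbhs_seg_sub oO (PO q Pq)) => z.
  exact: polyline_joined_seg.
have oOP : open (O `\` P).
  rewrite openE => q [Oq nPq].
  apply: filterS2 (nbhs_seg_sub oO Oq) (open_nbhs_nbhs (conj oO Oq)) => z qz Oz.
  split=> // Pz; apply: nPq; apply: polyline_joined_seg Pz _.
  by rewrite seg_sym.
suff CP : C `&` P = C by move: Cy; rewrite -CP => -[].
apply: cC; last 2 first.
- by exists P.
- exists (~` (O `\` P)); first exact: open_closedC.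
  by apply/seteqP; split=> q [Cq]; [move=> Pq; split=> // -[]|
    move/not_andP => [/(_ (CO q Cq))//|/contrapT]].
by exists x; split=> //; exists [::]; split=> //= _ ->; exact: CO.
Qed.

End Reachability.

Lemma closed_seg (R : realType) (V : normedModType R) (x y : V) :
  closed (seg x y).
Proof.
apply: compact_closed; first exact: norm_hausdorff.
apply: continuous_compact; last exact: segment_compact.
apply: continuous_subspaceT => t; apply: cvgD.
  by apply: cvgZ; [apply: cvgB; [exact: cvg_cst|exact: cvg_id]|exact: cvg_cst].
by apply: cvgZ; [exact: cvg_id|exact: cvg_cst].
Qed.

Lemma closed_polyline (R : realType) (V : normedModType R) (x : V) s :
  closed (polyline x s).
Proof.
elim: s x => [|y s IH] x /=; last exact/closedU/IH/closed_seg.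
exact/accessible_closed_set1/hausdorff_accessible/norm_hausdorff.
Qed.

(** * Crossings in the plane *)

Section Crossings.
Variable R : realFieldType.
Implicit Types (x y q : R * R) (s t : seq (R * R)) (c d : R).

Definition height x y c : R := x.2 + (c - x.1) / (y.1 - x.1) * (y.2 - x.2).

Definition shadow x y c : bool := (x.1 < c) (+) (y.1 < c).

(* The segment from [x] to [y] meets the upward ray from [q].  For a vertical
   segment the height is a junk value, but its shadow is empty. *)
Definition crosses x y q : bool := shadow x y q.1 && (q.2 < height x y q.1).

Lemma shadow_sym x y c : shadow y x c = shadow x y c.
Proof. exact: addbC. Qed.

Lemma height_sym x y c : x.1 != y.1 -> height y x c = height x y c.
Proof.
by move=> xy; rewrite /height; field; rewrite !subr_eq0 xy eq_sym xy.
Qed.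

Lemma crosses_sym x y q : x.1 != y.1 -> crosses y x q = crosses x y q.
Proof. by move=> xy; rewrite /crosses shadow_sym height_sym. Qed.

Lemma height_left x y : height x y x.1 = x.2.
Proof. by rewrite /height subrr !mul0r addr0. Qed.

Lemma height_right x y : x.1 != y.1 -> height x y y.1 = y.2.
Proof. by move=> xy; rewrite -height_sym // height_left. Qed.

Lemma height_conv x y c d (l : R) :
  height x y ((1 - l) * c + l * d) = (1 - l) * height x y c + l * height x y d.
Proof. by rewrite /height; ring. Qed.

Lemma seg_height x y c :
  x.1 < y.1 -> x.1 <= c <= y.1 -> seg x y (c, height x y c).
Proof.
move=> xy /andP[xc cy]; have d0 : 0 < y.1 - x.1 by rewrite subr_gt0.
exists ((c - x.1) / (y.1 - x.1)).
  rewrite /= in_itv /= divr_ge0 ?subr_ge0 ?(ltW xy) //=.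
  by rewrite ler_pdivrMr // mul1r lerD2r.
have d0' := lt0r_neq0 d0.
by congr pair; rewrite /height /= -![_ *: _]/(_ * _); field.
Qed.

(* If the sign of the difference of the two heights changed between [c] and [d],
   this affine function would vanish in between. *)
Lemma disjoint_seg_height_lt x x' y y' c d :
  seg x x' `&` seg y y' = set0 -> x.1 < x'.1 -> y.1 < y'.1 ->
  x.1 <= c <= x'.1 -> y.1 <= c <= y'.1 ->
  x.1 <= d <= x'.1 -> y.1 <= d <= y'.1 ->
  height x x' c < height y y' c -> height x x' d < height y y' d.
Proof.
move=> dis xx yy xc yc xd yd ltc; rewrite ltNge; apply/negP => led.
pose u := height y y' c - height x x' c.
pose v := height x x' d - height y y' d.
have u0 : 0 < u by rewrite subr_gt0.
have v0 : 0 <= v by rewrite subr_ge0.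
pose l := u / (u + v); have uv0 : 0 < u + v by rewrite ltr_wpDr.
have l0 : 0 <= l by rewrite divr_ge0 // ltW.
have l1 : l <= 1 by rewrite /l ler_pdivrMr // mul1r lerDl.
pose e := (1 - l) * c + l * d.
have le_conv (a b : R) : a <= c <= b -> a <= d <= b -> a <= e <= b.
  by rewrite /e; nra.
have he : height x x' e = height y y' e.
  apply/eqP; rewrite -subr_eq0 !height_conv.
  have -> : (1 - l) * height x x' c + l * height x x' d -
      ((1 - l) * height y y' c + l * height y y' d) = l * (u + v) - u.
    by rewrite /u /v; ring.
  by rewrite divfK ?subrr // lt0r_neq0.
suff : (seg x x' `&` seg y y') (e, height x x' e) by rewrite dis.
by split; [|rewrite he]; apply: seg_height => //; apply: le_conv.
Qed.

Lemma disjoint_seg_above x x' y y' :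
  seg x x' `&` seg y y' = set0 -> x.1 < x'.1 -> y.1 < y'.1 ->
  exists b : bool, forall c, x.1 <= c <= x'.1 -> y.1 <= c <= y'.1 ->
    (height y y' c < height x x' c) = b /\
    (height x x' c < height y y' c) = ~~ b.
Proof.
move=> dis xx yy.
have [[d [xd yd ltd]]|noabove] := pselect (exists d,
    [/\ x.1 <= d <= x'.1, y.1 <= d <= y'.1 & height x x' d < height y y' d]).
  exists false => c xc yc.
  have ltc := disjoint_seg_height_lt dis xx yy xd yd xc yc ltd.
  by rewrite ltc ltNge (ltW ltc).
exists true => c xc yc; apply/and_comm; split.
  by apply/negP => ltc; apply: noabove; exists c.
rewrite lt_neqAle leNgt; apply/andP; split; last first.
  by apply/negP => ltc; apply: noabove; exists c.
apply/eqP => eqh.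
suff : (seg x x' `&` seg y y') (c, height x x' c) by rewrite dis.
by split; [|rewrite -eqh]; exact: seg_height.
Qed.

Lemma shadow_between x y c : x.1 < y.1 -> shadow x y c -> x.1 <= c <= y.1.
Proof.
rewrite /shadow => xy; case: (ltP x.1 c) => [xc|cx]; case: (ltP y.1 c) => //=.
  by rewrite (ltW xc).
by move=> yc; lra.
Qed.

Lemma crosses_segs_lt x x' y y' :
  seg x x' `&` seg y y' = set0 -> x.1 < x'.1 -> y.1 < y'.1 ->
  x.1 != y.1 -> x.1 != y'.1 -> x'.1 != y.1 -> x'.1 != y'.1 ->
  crosses x x' y (+) crosses x x' y' (+) (crosses y y' x (+) crosses y y' x') =
  shadow x x' y.1 (+) shadow x x' y'.1.
Proof.
move=> dis xx yy xy xy' x'y x'y'; have [b bE] := disjoint_seg_above dis xx yy.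
have crossesxx q : y.1 <= q.1 <= y'.1 -> height y y' q.1 = q.2 ->
    crosses x x' q = shadow x x' q.1 && b.
  move=> yq hq; rewrite /crosses; case: (boolP (shadow _ _ _)) => //= sh.
  by have [<- _] := bE _ (shadow_between xx sh) yq; rewrite hq.
have crossesyy q : x.1 <= q.1 <= x'.1 -> height x x' q.1 = q.2 ->
    crosses y y' q = shadow y y' q.1 && ~~ b.
  move=> xq hq; rewrite /crosses; case: (boolP (shadow _ _ _)) => //= sh.
  by have [_ <-] := bE _ xq (shadow_between yy sh); rewrite hq.
rewrite !crossesxx ?crossesyy ?height_left ?height_right ?lexx ?ltW ?lt_eqF //.
rewrite /shadow; case: (ltgtP x.1 y.1) xy => //;
case: (ltgtP x.1 y'.1) xy' => //; case: (ltgtP x'.1 y.1) x'y => //;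
by case: (ltgtP x'.1 y'.1) x'y' => //; case: (b).
Qed.

Lemma crosses_segs x x' y y' :
  seg x x' `&` seg y y' = set0 -> {in [:: x; x'; y; y'] &, injective fst} ->
  crosses x x' y (+) crosses x x' y' (+) (crosses y y' x (+) crosses y y' x') =
  shadow x x' y.1 (+) shadow x x' y'.1.
Proof.
move=> dis inj; have mem4 := (in_cons, eqxx, orbT).
have ne a b : seg x x' a -> seg y y' b ->
    a \in [:: x; x'; y; y'] -> b \in [:: x; x'; y; y'] -> a.1 != b.1.
  move=> xa yb ia ib; apply/eqP => /(inj _ _ ia ib) ab.
  by have : (seg x x' `&` seg y y') a; [split=> //; rewrite ab | rewrite dis].
have [[xl xr] [yl yr]] :=
  ((seg_left x x', seg_right x x'), (seg_left y y', seg_right y y')).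
have xy : x.1 != y.1 by apply: ne; rewrite ?mem4.
have xy' : x.1 != y'.1 by apply: ne; rewrite ?mem4.
have x'y : x'.1 != y.1 by apply: ne; rewrite ?mem4.
have x'y' : x'.1 != y'.1 by apply: ne; rewrite ?mem4.
have crosses0 a q : crosses a a q = false by rewrite /crosses /shadow addbb.
have [xx|xx] := eqVneq x.1 x'.1.
  by rewrite (inj x x') ?mem4 // !crosses0 /= addbb /shadow !addbb.
have [yy|yy] := eqVneq y.1 y'.1.
  by rewrite (inj y y') ?mem4 // !crosses0 !addbb.
wlog ltx : x x' dis xx {inj ne xl xr} xy xy' x'y x'y' / x.1 < x'.1.
  move=> W; case: (ltgtP x.1 x'.1) (xx) => // h _; first exact: W.
  rewrite -!(crosses_sym _ xx) [crosses y y' x (+) _]addbC -!(shadow_sym x x').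
  by apply: W => //; [rewrite seg_sym|rewrite eq_sym].
wlog lty : y y' dis yy {yl yr} xy xy' x'y x'y' / y.1 < y'.1.
  move=> W; case: (ltgtP y.1 y'.1) (yy) => // h _; first exact: W.
  rewrite -!(crosses_sym _ yy) [crosses x x' y (+) _]addbC [RHS]addbC.
  by apply: W => //; [rewrite (seg_sym y')|rewrite eq_sym].
exact: crosses_segs_lt.
Qed.

Definition crossings x s q : bool :=
  \big[addb/false]_(e <- edges x s) crosses e.1 e.2 q.

Lemma crossings_polylines x s y t :
  polyline x s `&` polyline y t = set0 ->
  {in x :: s ++ y :: t &, injective fst} ->
  crossings x s y (+) crossings x s (last y t) (+)
    (crossings y t x (+) crossings y t (last x s)) =
  shadow x (last x s) y.1 (+) shadow x (last x s) (last y t).1.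
Proof.
move=> dis inj.
transitivity (\big[addb/false]_(e <- edges x s)
  \big[addb/false]_(d <- edges y t)
   ((crosses e.1 e.2 d.1 (+) crosses e.1 e.2 d.2) (+)
    (crosses d.1 d.2 e.1 (+) crosses d.1 d.2 e.2))).
  under eq_bigr do rewrite big_split /= (big_addb_edges (crosses _ _)).
  rewrite !big_split exchange_big /=; congr addb.
  under [RHS]eq_bigr do rewrite (big_addb_edges (crosses _ _)).
  by rewrite big_split.
rewrite /shadow -(big_addb_edges (fun q => q.1 < y.1)).
rewrite -(big_addb_edges (fun q => q.1 < (last y t).1)) -big_split /=.
rewrite !big_seq; apply: eq_bigr => e eI.
rewrite -(big_addb_edges (fun q => shadow e.1 e.2 q.1)).
rewrite !big_seq; apply: eq_bigr => d dI.
apply: crosses_segs.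
  rewrite -subset0 -dis; apply: setISS; exact: edge_sub_polyline.
apply: sub_in2 inj => q; rewrite !in_cons mem_cat.
have /andP[] := mem_edges eI; have /andP[] := mem_edges dI; rewrite !in_cons.
move=> d1 d2 e1 e2; rewrite in_nil orbF.
by case/or4P => /eqP ->; rewrite ?orbA ?e1 ?e2 //; rewrite -orbA ?d1 ?d2 !orbT.
Qed.

End Crossings.

(** * Drawings of K_{3,3} *)

Section Drawings.
Variables (R : numDomainType) (V : lmodType R).
Implicit Types (v w : 'I_3 -> V) (s : 'I_3 -> 'I_3 -> seq V).

(* The edge from [v i] to [w j] has the further vertices [s i j]; only
   independent edges are required to be disjoint. *)
Definition K33_drawing v w s :=
  (forall i j, last (v i) (s i j) = w j) /\
  (forall i j k l : 'I_3, (i < k)%N -> j != l ->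
    polyline (v i) (s i j) `&` polyline (v k) (s k l) = set0).

Definition K33_points v s : seq V :=
  [seq q | p <- enum {: 'I_3 * 'I_3}, q <- v p.1 :: s p.1 p.2].

Lemma mem_K33_points v s i j : {subset v i :: s i j <= K33_points v s}.
Proof.
by move=> q qI; apply/allpairsPdep; exists (i, j), q; rewrite mem_enum.
Qed.

End Drawings.

Lemma K33_drawing_image (R : numDomainType) (V W : lmodType R)
    (f : {linear V -> W}) (v w : 'I_3 -> V) (s : 'I_3 -> 'I_3 -> seq V) :
  injective f -> K33_drawing v w s ->
  K33_drawing (f \o v) (f \o w) (fun i j => map f (s i j)).
Proof.
move=> injf [sw dis]; split=> [i j|i j k l ik jl] /=.
  by rewrite last_map sw.
rewrite !polyline_image -subset0 => _ [[x xij <-] [y ykl /injf yx]].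
have /disjoints_subset := dis i j k l ik jl.
by apply; [exact: xij|rewrite -yx].
Qed.

Section PlaneDrawings.
Variable R : realFieldType.
Implicit Types (v w : 'I_3 -> R * R) (s : 'I_3 -> 'I_3 -> seq (R * R)).

(* The Hanani-Tutte argument. *)
Lemma no_generic_K33_drawing v w s :
  {in K33_points v s &, injective fst} -> ~ K33_drawing v w s.
Proof.
move=> inj [sw dis]; have sub i j := @mem_K33_points _ _ v s i j.
have w_inj (j l : 'I_3) : j != l -> (w j).1 != (w l).1.
  have wI k : w k \in K33_points v s.
    by apply: (sub 0 k); rewrite -(sw 0) mem_last.
  move=> jl; apply/eqP => /(inj _ _ (wI j) (wI l)) wjl.
  have := dis 0 j 1 l isT jl; apply/eqP/set0P; exists (w j).
  by split; [rewrite -(sw 0)|rewrite wjl -(sw 1)]; exact: polyline_last.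
apply: (@K33_parity (fun i j k => crossings (v i) (s i j) (v k))
  (fun i j l => crossings (v i) (s i j) (w l)) (fun i k => (v i).1 < (v k).1)
  (fun j l => (w j).1 < (w l).1) (fun i l => (v i).1 < (w l).1)
  (fun j k => (w j).1 < (v k).1)) => [j l /w_inj|i j k l ik jl].
  by case: ltgtP.
have := crossings_polylines (dis i j k l ik jl); rewrite !sw; apply.
apply: sub_in2 inj => q; rewrite -cat_cons mem_cat => /orP[]; exact: sub.
Qed.

Definition shear (m : R) (q : R * R) : R * R := (q.1 + m * q.2, q.2).

Lemma shear_is_linear m : linear (shear m).
Proof.
move=> a x y; rewrite /shear; congr pair.
by rewrite /= -![_ *: _]/(_ * _); ring.
Qed.

HB.instance Definition _ m :=
  GRing.isLinear.Build R (R * R)%type (R * R)%type _ (shear m)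
    (shear_is_linear m).

Lemma shear_inj m : injective (shear m).
Proof. by move=> [a b] [c d] [ac bd]; move: ac; rewrite /= bd => /addIr ->. Qed.

(* [m] has to avoid the finitely many values for which some two of the points
   lie on a common line of slope [- m^-1]. *)
Lemma generic_shear (A : seq (R * R)) :
  exists m, {in A &, injective (fst \o shear m)}.
Proof.
pose bad := [seq (x.1 - y.1) / (y.2 - x.2) | x <- A, y <- A].
pose m := 1 + \sum_(c <- bad) `|c|.
have mbad : m \notin bad.
  apply/negP => mI; suff : m <= \sum_(c <- bad) `|c| by rewrite /m; lra.
  by rewrite (big_rem m mI) /= (le_trans (ler_norm m)) // lerDl sumr_ge0.
exists m => x y xA yA; rewrite /shear /= => e.
have [e2|ne2] := eqVneq x.2 y.2.
  by apply: (@shear_inj m); rewrite /shear e e2.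
case/negP: mbad; have -> : m = (x.1 - y.1) / (y.2 - x.2).
  have d0 : y.2 - x.2 != 0 by rewrite subr_eq0 eq_sym.
  by apply: (mulIf d0); rewrite divfK //; lra.
exact: allpairs_f.
Qed.

Theorem no_K33_drawing v w s : ~ K33_drawing v w s.
Proof.
move=> drawing; have [m inj] := generic_shear (K33_points v s).
have := K33_drawing_image (@shear_inj m) drawing; apply: no_generic_K33_drawing.
move=> _ _ /allpairsPdep[p [q [_ qI ->]]] /allpairsPdep[p' [q' [_ qI' ->]]].
move: qI qI'; rewrite /= -!map_cons => /mapP[x xI ->] /mapP[y yI ->] e.
rewrite (inj x y _ _ e) //; first exact: mem_K33_points xI.
exact: mem_K33_points yI.
Qed.

End PlaneDrawings.

Section NoPlanarK33.
Variable R : realType.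
Implicit Types (P Q C : 'I_3 -> set (R * R)) (u : 'I_3 -> R * R).

Lemma no_K33_connected P Q C a b p u :
  (forall j, [/\ open (P j), connected (P j), P j a & P j (u j)]) ->
  (forall j, [/\ open (Q j), connected (Q j), Q j b & Q j (u j)]) ->
  (forall j, [/\ connected (C j), C j p & C j (u j)]) ->
  ~ (forall j l, j != l ->
    [/\ P j `&` Q l = set0, P j `&` C l = set0 & Q j `&` C l = set0]).
Proof.
move=> connP connQ connC dis.
have /choice[sP sPE] j : polyline_joined (P j) a (u j).
  by have [oP cP Pa Pu] := connP j; exact: connected_polyline_joined cP Pa Pu.
have /choice[sQ sQE] j : polyline_joined (Q j) b (u j).
  by have [oQ cQ Qb Qu] := connQ j; exact: connected_polyline_joined cQ Qb Qu.
pose K l := \bigcup_(j in [set j | j != l])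
  (polyline a (sP j) `|` polyline b (sQ j)).
have closedK l : closed (K l).
  apply: closed_bigcup => [|j _]; first exact: finite_finset.
  by apply: closedU; exact: closed_polyline.
have CK l : C l `<=` ~` K l.
  move=> q Cq [j /= jl].
  have [_ /disjoints_subset PC /disjoints_subset QC] := dis j l jl.
  by have [[_ sP'] [_ sQ']] := (sPE j, sQE j); case=> [/sP'/PC|/sQ'/QC].
have /choice[sC sCE] l : polyline_joined (~` K l) p (u l).
  have [cC Cp Cu] := connC l.
  by apply: connected_polyline_joined (CK l) cC Cp Cu; exact: closed_openC.
have disPQ j l : j != l -> polyline a (sP j) `&` polyline b (sQ l) = set0.
  move=> jl; have [PQ _ _] := dis j l jl; rewrite -subset0 -PQ.
  by apply: setISS; [case: (sPE j)|case: (sQE l)].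
have disK j l : j != l ->
    (polyline a (sP j) `|` polyline b (sQ j)) `&` polyline p (sC l) = set0.
  move=> jl; rewrite -subset0 => q [PQq Cq]; have [_ sK] := sCE l.
  by apply: (sK q Cq); exists j.
apply: (@no_K33_drawing R (fun i => nth p [:: a; b] i) u
  (fun i => nth sC [:: sP; sQ] i)); split.
  by case=> [[|[|[|//]]] i3] j /=; [case: (sPE j)|case: (sQE j)|case: (sCE j)].
case=> [[|[|[|//]]] i3] j [[|[|[|//]]] k3] l //= _ jl; first exact: disPQ.
- by move: (disK j l jl); rewrite setIUl setU_eq0 => -[].
- by move: (disK j l jl); rewrite setIUl setU_eq0 => -[].
Qed.

End NoPlanarK33.

(** * Regular closed sets *)

Section RegularClosed.
Variable T : topologicalType.
Implicit Types (A B G X Y Z b r s z : set T) (p q : T).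

Lemma connected_between A B :
  connected A -> A `<=` B -> B `<=` closure A -> connected B.
Proof.
move=> cA AB BA; apply/connectedP => E [E0 BE sepE].
have [c AEc] : exists c, A `<=` E c.
  move: AB; rewrite BE => AB.
  by have [?|?] := connected_subset sepE AB cA; [exists false|exists true].
have [y Ey] := E0 (~~ c).
have By : B y by rewrite BE; case: (c) Ey; [left|right].
have cEy : closure (E c) y by apply: (closureS AEc); exact: BA.
have [/disjoints_subset clFT /disjoints_subset FclT] := sepE.
by case: c Ey cEy {AEc} => [/FclT|Ey /clFT].
Qed.

Lemma open_disjoint_closure A G :
  open G -> G `&` A = set0 -> G `&` closure A = set0.
Proof.
move=> oG GA; rewrite -subset0 => q [Gq /(_ G (open_nbhs_nbhs (conj oG Gq)))].
by rewrite setIC GA => -[].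
Qed.

Lemma connected_interior_dense G X :
  open G -> connected G -> G `<=` X -> X `<=` closure G -> connected X°.
Proof.
move=> oG cG GX XG; apply: connected_between cG _ _.
  by rewrite -open_subsetE.
exact: subset_trans (@interior_subset _ X) XG.
Qed.

Lemma rc_mulC X Y : rc_mul X Y = rc_mul Y X.
Proof. by rewrite /rc_mul setIC. Qed.

Lemma rc_mul_closure_eq0 A B :
  open A -> A `&` B = set0 -> rc_mul (closure A) (closure B) = set0.
Proof.
move=> oA AB; rewrite /rc_mul; set O := (_ `&` _)°.
have Osub : O `<=` closure A `&` closure B by exact: interior_subset.
suff -> : O = set0 by exact: closure0.
rewrite -[LHS](setIidl (subset_trans Osub (@subIsetl _ _ _))).
apply: open_disjoint_closure; first exact: open_interior.
rewrite -subset0 -(open_disjoint_closure oA AB) => q [/Osub[_ Bq] Aq].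
by split.
Qed.

Lemma regclosedU X Y : regclosed X -> regclosed Y -> regclosed (X `|` Y).
Proof.
move=> rX rY; pose I n := if n is 0%N then X else Y.
by apply: (@term_val_RC _ I (TAdd (TVar 0) (TVar 1))) => -[].
Qed.

Lemma regclosed_meets X G :
  regclosed X -> open G -> X `&` G !=set0 -> X° `&` G !=set0.
Proof.
by move=> rX oG [q []]; rewrite -{1}rX => Xq Gq; exact/Xq/open_nbhs_nbhs.
Qed.

Lemma regclosed_interior_neq0 X : regclosed X -> X !=set0 -> X° !=set0.
Proof.
move=> rX X0; have := @regclosed_meets X setT rX openT.
by rewrite !setIT; exact.
Qed.

Lemma rc_mul_eq0 X Y : regclosed Y -> rc_mul X Y = set0 -> X° `&` Y = set0.
Proof.
move=> rY XY; apply/eqP/negPn/negP => /set0P; rewrite setIC => XY0.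
have [x [Yx Xx]] := regclosed_meets rY (open_interior X) XY0.
suff : rc_mul X Y x by rewrite XY.
by apply: subset_closure; rewrite interiorI.
Qed.

Lemma connected_interiorU X Z q : regclosed X -> regclosed Z ->
  connected X° -> connected Z° ->
  (X `|` Z)° q -> X q -> Z q -> connected (X `|` Z)°.
Proof.
move=> rX rZ cX cZ Oq Xq Zq; set O := (X `|` Z)° in Oq *.
have part Y : regclosed Y -> connected Y° -> Y `<=` X `|` Z ->
    connected (O `&` Y).
  move=> rY cY sY; apply: connected_between cY _ _.
    by move=> x Yx; split; [exact: interiorS sY x Yx|exact: interior_subset].
  by rewrite rY => x [].
have -> : O = (O `&` X) `|` (O `&` Z).
  by rewrite -setIUr; apply/esym/setIidl; exact: interior_subset.
apply: connectedU; first by exists q.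
- by apply: part => // x; left.
- by apply: part => // x; right.
Qed.

Lemma connected_interiorU_meet Y Z : closed Y -> closed Z ->
  Y° !=set0 -> Z° !=set0 -> connected (Y `|` Z)° ->
  (Y `|` Z)° `&` (Y `&` Z) !=set0.
Proof.
move=> clY clZ [y Yy] [x Zx] cO; set O := (Y `|` Z)° in cO *.
have sub : O `<=` Y `|` Z by exact: interior_subset.
have [//|/set0P/negP/negPn/eqP/disjoints_subset OYZ] :=
  pselect (O `&` (Y `&` Z) !=set0).
have OZ : O `&` Z = O.
  apply: cO; last by exists Z.
    exists x; split; last exact: interior_subset.
    by apply: interiorS Zx => ?; right.
  exists (~` Y); first exact: closed_openC.
  apply/seteqP; split=> q [Oq Zq]; split=> //; last by case: (sub q Oq).
  by move=> Yq; exact: (OYZ q Oq).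
have Oy : O y by apply: interiorS Yy => ?; left.
exists y; split=> //; split; first exact: interior_subset.
by move: Oy; rewrite -OZ => -[].
Qed.

(* A contact point of [b + r] and [z] cannot be interior to their union, so
   every neighbourhood of it reaches into [s]. *)
Lemma contact_limit b r s z p :
  regclosed (b `|` r) -> regclosed z -> closed s ->
  connected (b `|` r)° -> connected z° -> ~ connected (b `|` r `|` z)° ->
  (z `|` (r `|` s))° p -> z p -> r p -> s p.
Proof.
move=> rbr rz cls cbr cz ncbrz Op zp rp; apply: contrapT => nsp; apply: ncbrz.
apply: (connected_interiorU rbr rz cbr cz _ _ zp); last by right.
have Nsp := open_nbhs_nbhs (conj (closed_openC cls) nsp).
apply: filterS2 Nsp Op => q nsq [zq|[rq|//]]; first by right.
by left; right.
Qed.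

Lemma triple_contact b r s z :
  regclosed (b `|` r) -> regclosed (b `|` s) ->
  regclosed z -> regclosed r -> closed s ->
  connected (b `|` r)° -> connected (b `|` s)° -> connected z° ->
  connected (z `|` (r `|` s))° -> z !=set0 -> r !=set0 ->
  ~ connected (b `|` r `|` z)° -> ~ connected (b `|` s `|` z)° ->
  exists p, [/\ z p, r p & s p].
Proof.
move=> rbr rbs rz rr cls cbr cbs cz czrs z0 r0 ncr ncs.
have clr := regclosed_closed rr.
have [x rx] := regclosed_interior_neq0 rr r0.
have rs0 : (r `|` s)° !=set0 by exists x; apply: interiorS rx => ?; left.
have [p [Op [zp rsp]]] := connected_interiorU_meet (regclosed_closed rz)
  (closedU clr cls) (regclosed_interior_neq0 rz z0) rs0 czrs.
exists p; case: rsp => [rp|sp]; split=> //.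
  exact: contact_limit rbr rz cls cbr cz ncr Op zp rp.
move: Op; rewrite [r `|` s]setUC => Op.
exact: contact_limit rbs rz clr cbs cz ncs Op zp sp.
Qed.

Lemma component_meets_interior X p :
  regclosed X -> finitely_many_components X -> X p ->
  X° `&` connected_component X p !=set0.
Proof.
move=> rX finX Xp.
pose F := \bigcup_(A in connected_components X `\`
  [set connected_component X p]) A.
have clF : closed F.
  apply: closed_bigcup => [|_ [[x Xx <-] _]]; first exact: finite_setD.
  exact: component_closed (regclosed_closed rX).
have nFp : (~` F) p.
  by move=> [_ [[x Xx <-] neq] /same_connected_component].
have /= [u [Xu nFu]] : X° `&` ~` F !=set0.
  by apply: regclosed_meets => //; [exact: closed_openC|exists p].
exists u; split=> //; have Xu' := interior_subset Xu.
have uu := connected_component_refl Xu'.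
apply: contrapT => npu; apply: nFu; exists (connected_component X u) => //.
by split; [exists u|move=> /= E; apply: npu; rewrite -E].
Qed.

End RegularClosed.

(** * Products *)

Section Products.
Variables T U : topologicalType.
Implicit Types (A S : set T) (B C : set U).

Lemma openX A B : open A -> open B -> open (A `*` B).
Proof.
move=> oA oB; rewrite openE => -[x y] [Ax By]; exists (A, B) => //.
by split; apply: open_nbhs_nbhs.
Qed.

Lemma closureX A B : closure (A `*` B) = closure A `*` closure B.
Proof.
apply/seteqP; split=> [[x y] ABxy|[x y] [/= Ax By] D [[G H] /= [Gx Hy] GHD]].
  split=> /= D Dxy.
    by have [[a b] [[Aa _] Da]] := ABxy _ (cvg_fst Dxy); exists a.
  by have [[a b] [[_ Bb] Db]] := ABxy _ (cvg_snd Dxy); exists b.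
have [[a [Aa Ga]] [b [Bb Hb]]] := (Ax G Gx, By H Hy).
by exists (a, b); split=> //; exact: GHD.
Qed.

Lemma connected_setU_bigcup (I : Type) (P : set I) A (F : I -> set T) :
  connected A -> (forall i, P i -> connected (F i)) ->
  (forall i, P i -> A `&` F i !=set0) -> connected (A `|` \bigcup_(i in P) F i).
Proof.
move=> cA cF AF; have [->|/set0P[i Pi]] := eqVneq P set0.
  by rewrite bigcup_set0 setU0.
have -> : A `|` \bigcup_(i in P) F i = \bigcup_(i in P) (A `|` F i).
  apply/seteqP; split=> q; last first.
    by move=> [j Pj [Aq|Fq]]; [left|right; exists j].
  by case=> [Aq|[j Pj Fq]]; [exists i => //; left|exists j => //; right].
apply: bigcup_connected => [|j Pj].
  by have [q [Aq _]] := AF i Pi; exists q => j _; left.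
by apply: connectedU; [exact: AF|exact: cA|exact: cF].
Qed.

End Products.

Section ConnectedProducts.
Variables T U : topologicalType.
Implicit Types (A S : set T) (B C : set U).

Lemma connected_set1X (x : T) B : connected B -> connected ([set x] `*` B).
Proof.
move=> cB; have -> : [set x] `*` B = pair x @` B.
  by apply/seteqP; split=> [[_ y] [/= -> By]|_ [y By <-]]; [exists y|].
apply: connected_continuous_connected => //; apply: continuous_subspaceT => y.
by apply: cvg_pair; [exact: cvg_cst|exact: cvg_id].
Qed.

Lemma connected_setX1 A (y : U) : connected A -> connected (A `*` [set y]).
Proof.
move=> cA; have -> : A `*` [set y] = pair^~ y @` A.
  by apply/seteqP; split=> [[x _] [/= Ax ->]|_ [x Ax <-]]; [exists x|].
apply: connected_continuous_connected => //; apply: continuous_subspaceT => x.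
by apply: cvg_pair; [exact: cvg_id|exact: cvg_cst].
Qed.

Lemma connected_setX_teeth A S B C : connected (A `*` C) -> connected B ->
  S `<=` A -> C `&` B !=set0 -> connected (A `*` C `|` S `*` B).
Proof.
move=> cAC cB SA [y [Cy By]].
have -> : S `*` B = \bigcup_(x in S) ([set x] `*` B).
  by apply/seteqP; split=> [[x z] [Sx Bz]|[_ z] [x Sx [/= -> Bz]]]; [exists x|].
apply: connected_setU_bigcup => // x Sx; first exact: connected_set1X.
by exists (x, y); split; split=> //; exact: SA.
Qed.

Lemma connected_setX A B : connected A -> connected B -> connected (A `*` B).
Proof.
move=> cA cB; have [->|/set0P[y By]] := eqVneq B set0.
  by rewrite setX0; exact: connected0.
have -> : A `*` B = A `*` [set y] `|` A `*` B.
  by apply/esym/setUidPr => -[x z] [/= ? ->].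
by apply: connected_setX_teeth => //; [exact: connected_setX1|exists y].
Qed.

End ConnectedProducts.

(** * Strip configurations *)

Lemma ord3_ind (P : 'I_3 -> Prop) : P 0 -> P 1 -> P 2 -> forall i, P i.
Proof.
by move=> P0 P1 P2 [[|[|[|//]]] i3]; [move: P0|move: P1|move: P2];
  congr P; exact: val_inj.
Qed.

Record strip_configuration (T : topologicalType) (a b z : set T)
    (t : 'I_3 -> set T) : Prop := StripConfiguration {
  strip_a_neq0 : a !=set0;
  strip_b_neq0 : b !=set0;
  strip_z_neq0 : z !=set0;
  strip_t0_neq0 : t 0 !=set0;
  strip_z_sub_t2 : z `<=` t 2;
  strip_connected_a : forall i, connected (a `|` t i)°;
  strip_connected_b : forall i, connected (b `|` t i)°;
  strip_connected_z : connected z°;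
  strip_connected_z01 : connected (z `|` (t 0 `|` t 1))°;
  strip_disconnected_b0z : ~ connected (b `|` t 0 `|` z)°;
  strip_disconnected_b1z : ~ connected (b `|` t 1 `|` z)°;
  strip_mul_eq0 : forall i j, i != j -> rc_mul (a `|` t i) (b `|` t j) = set0
}.

Definition FTrue : formula := FEq TZero TZero.

Lemma satisfies_bigand (T : topologicalType) (I : nat -> set T) (J : finType)
    (P : pred J) (F : J -> formula) :
  satisfies I (\big[FAnd/FTrue]_(j | P j) F j) <->
  forall j, P j -> satisfies I (F j).
Proof.
suff bigandP s : satisfies I (\big[FAnd/FTrue]_(j <- s | P j) F j) <->
    forall j, j \in s -> P j -> satisfies I (F j).
  rewrite bigandP; split=> sat j; last by move=> _; exact: sat.
  by apply: sat; rewrite mem_index_enum.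
elim: s => [|i s IH]; first by rewrite big_nil; split.
rewrite big_cons; case: ifP => Pi /=; last first.
  rewrite IH; split=> sat j js; last by apply: sat; rewrite in_cons js orbT.
  by move: js; rewrite in_cons => /predU1P[->|/sat//]; rewrite Pi.
rewrite IH; split=> [[Fi sat] j|sat]; last first.
  by split=> [|j js]; apply: sat; rewrite ?mem_head // in_cons js orbT.
by rewrite in_cons => /predU1P[->|/sat].
Qed.

Definition strip_formula : formula :=
  let a := TVar 3 in let b := TVar 4 in let z := TVar 5 in
  let t (i : 'I_3) := TVar i in
  foldr FAnd FTrue [::
    FNot (FEq a TZero); FNot (FEq b TZero); FNot (FEq z TZero);
    FNot (FEq (t 0) TZero); FEq (TAdd z (t 2)) (t 2);
    \big[FAnd/FTrue]_i FIntConn (TAdd a (t i));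
    \big[FAnd/FTrue]_i FIntConn (TAdd b (t i));
    FIntConn z; FIntConn (TAdd z (TAdd (t 0) (t 1)));
    FNot (FIntConn (TAdd (TAdd b (t 0)) z));
    FNot (FIntConn (TAdd (TAdd b (t 1)) z));
    \big[FAnd/FTrue]_(p : 'I_3 * 'I_3 | p.1 != p.2)
      FEq (TMul (TAdd a (t p.1)) (TAdd b (t p.2))) TZero].

Lemma satisfies_strip_formula (T : topologicalType) (I : nat -> set T) :
  satisfies I strip_formula <->
  strip_configuration (I 3%N) (I 4%N) (I 5%N) (fun i : 'I_3 => I i).
Proof.
have neq0P (A : set T) : ~ A = set0 <-> A !=set0.
  by rewrite -set0P; split=> /eqP.
rewrite /= !satisfies_bigand /= !neq0P setUidPr.
split=> [[? [? [? [? [? [ca [cb [? [? [? [? [mul0 _]]]]]]]]]]]]|].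
  split=> // i; [exact: ca|exact: cb|].
  by move=> j ij; exact: (mul0 (i, j)).
move=> [? ? ? ? ? ca cb ? ? ? ? mul0]; do 5! [apply: conj=> //].
apply: conj=> [i _|]; first exact: ca.
apply: conj=> [i _|]; first exact: cb.
by do 4! [apply: conj=> //]; apply: conj=> // -[i j]; exact: mul0.
Qed.

Section Impossibility.
Variable R : realType.
Implicit Types (a b z : set (R * R)) (t C : 'I_3 -> set (R * R)).

Lemma no_K33_regions a b p t C :
  (forall i, regclosed (a `|` t i)) -> (forall i, regclosed (b `|` t i)) ->
  a° !=set0 -> b° !=set0 ->
  (forall i, connected (a `|` t i)°) -> (forall i, connected (b `|` t i)°) ->
  (forall i, [/\ connected (C i), C i `<=` t i & C i p]) ->
  (forall i, (t i)° `&` C i !=set0) ->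
  ~ (forall i j, i != j -> rc_mul (a `|` t i) (b `|` t j) = set0).
Proof.
move=> rat rbt [x aox] [y boy] cona conb CE /choice[u uE] mul0.
apply: (@no_K33_connected R (fun i => (a `|` t i)°) (fun i => (b `|` t i)°)
  C x y p u).
- move=> i; split=> //; first exact: open_interior.
  + by apply: interiorS aox => ?; left.
  + by have [ui _] := uE i; apply: interiorS ui => ?; right.
- move=> i; split=> //; first exact: open_interior.
  + by apply: interiorS boy => ?; left.
  + by have [ui _] := uE i; apply: interiorS ui => ?; right.
- by move=> i; have [cC _ Cp] := CE i; have [_ Cu] := uE i.
move=> i j ij; have abt := rc_mul_eq0 (rbt j) (mul0 i j ij).
have bat : (b `|` t i)° `&` (a `|` t j) = set0.
  by apply: rc_mul_eq0 => //; rewrite rc_mulC mul0 // eq_sym.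
have Ct A : C j `<=` A `|` t j by have [_ Ct _] := CE j; move=> q /Ct; right.
split; rewrite -subset0.
- by rewrite -abt; apply: setIS; exact: interior_subset.
- by rewrite -abt; exact: setIS (Ct b).
- by rewrite -bat; exact: setIS (Ct a).
Qed.

Theorem no_finite_strip_configuration a b z t :
  regclosed a -> regclosed b -> regclosed z -> (forall i, regclosed (t i)) ->
  (forall i, i != 2 -> finitely_many_components (t i)) ->
  ~ strip_configuration a b z t.
Proof.
move=> ra rb rz rt fin [a0 b0 z0 r0 zt2 ca cb cz cz01 nc0 nc1 mul0].
have [p [zp p0 p1]] := triple_contact (regclosedU rb (rt 0))
  (regclosedU rb (rt 1)) rz (rt 0) (regclosed_closed (rt 1)) (cb 0) (cb 1)
  cz cz01 z0 r0 nc0 nc1.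
have tp : forall i, t i p by apply: ord3_ind => //; exact: zt2.
pose C i := if i == 2 then z else connected_component (t i) p.
apply: (@no_K33_regions a b p t C) mul0 => //.
- by move=> i; exact: regclosedU.
- by move=> i; exact: regclosedU.
- exact: regclosed_interior_neq0.
- exact: regclosed_interior_neq0.
- move=> i; rewrite /C; case: eqVneq => [->|_].
    by split=> //; rewrite -rz; exact: connected_closure.
  split; [exact: component_connected|exact: connected_component_sub|].
  exact: connected_component_refl.
- move=> i; rewrite /C; case: eqVneq => [->|i2]; last first.
    exact: component_meets_interior (fin i i2) _.
  have [x zx] := regclosed_interior_neq0 rz z0.
  by exists x; split; [exact: interiorS zx|exact: interior_subset].
Qed.

End Impossibility.

(** * A configuration with infinitely many strips *)

Section RealLine.
Variable R : realType.

Lemma connected_itv (i : interval R) : connected [set` i].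
Proof. exact/connected_intervalP/interval_is_interval. Qed.

Lemma closure_itvNyo (x : R) : closure `]-oo, x[ = `]-oo, x]%classic.
Proof. by rewrite set_itvNyo set_itvNyc closure_lt. Qed.

Lemma closure_itvoy (x : R) : closure `]x, +oo[ = `[x, +oo[%classic.
Proof. by rewrite set_itvoy set_itvcy closure_gt. Qed.

Lemma connected_ivt (T : topologicalType) (f : T -> R) (A : set T) x y c :
  continuous f -> connected A -> A x -> A y -> f x <= c <= f y ->
  exists2 z, A z & f z = c.
Proof.
move=> cf cA Ax Ay fxy.
have /connected_intervalP itvfA : connected (f @` A).
  by apply: connected_continuous_connected => //; exact: continuous_subspaceT.
by apply: itvfA fxy; [exists x|exists y].
Qed.

End RealLine.

Section Model.
Variable R : realType.
Implicit Types (S : set R).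

Definition upper : set (R * R) := setT `*` `]1, +oo[.
Definition lower_left : set (R * R) := `]-oo, 0[ `*` `]-oo, -1[.
Definition right_below : set (R * R) := `]0, +oo[ `*` `]-oo, 1[.
Definition strip S : set (R * R) := S `*` `]-1, 1[.
Definition right_strip : set (R * R) := strip `]0, +oo[.

Lemma open_strip S : open S -> open (strip S).
Proof. by move=> oS; apply: openX => //; exact: interval_open. Qed.

Lemma open_upper : open upper.
Proof. by apply: openX; [exact: openT|exact: interval_open]. Qed.

Lemma open_lower_left : open lower_left.
Proof. by apply: openX; exact: interval_open. Qed.

Lemma open_right_below : open right_below.
Proof. by apply: openX; exact: interval_open. Qed.

Lemma closure_upper : closure upper = setT `*` `[1, +oo[.
Proof. by rewrite closureX closureT closure_itvoy. Qed.

Lemma closure_lower_left : closure lower_left = `]-oo, 0] `*` `]-oo, -1].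
Proof. by rewrite closureX !closure_itvNyo. Qed.

(* The bound [l] is [BRight (-1)] for [strip S] and [-oo] for [right_below]. *)
Lemma connected_upperU S (l : itv_bound R) :
  open S -> open [set` Interval l +oo%O] -> (l <= BLeft 1)%O ->
  connected (closure upper `|` closure (S `*` [set` Interval l (BLeft 1)]))°.
Proof.
move=> oS ol l1; pose G := upper `|` S `*` [set` Interval l +oo%O].
apply: (@connected_interior_dense _ G).
- by apply: openU; [exact: open_upper|exact: openX].
- apply: connected_setX_teeth => //; try exact: connected_itv.
  + by apply: connected_setX; [rewrite -set_itvNyy|]; exact: connected_itv.
  + exists 2; split; rewrite /= itv_boundlr ?bnd_simp; first lra.
    by rewrite (le_trans l1) // bnd_simp; lra.
- move=> [x y] [[_ /= y1]|[/= Sx ly]]; first by left; exact: subset_closure.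
  have [y1|y1] := ltP y 1; last first.
    by left; rewrite closure_upper; split=> //=; rewrite in_itv /= y1.
  right; apply: subset_closure; split=> //=; move: ly.
  by rewrite !itv_boundlr /= => /andP[-> _]; rewrite bnd_simp.
- rewrite -closureU; apply/closureS/setUS => -[x y] [Sx].
  by rewrite /= !itv_boundlr => /andP[-> _].
Qed.

Lemma connected_lower_strip S : open S -> S `<=` `]-oo, 0[ ->
  connected (closure lower_left `|` closure (strip S))°.
Proof.
move=> oS Sneg; pose G := lower_left `|` S `*` `]-oo, 1[.
apply: (@connected_interior_dense _ G).
- apply: openU; first exact: open_lower_left.
  by apply: openX => //; exact: interval_open.
- apply: connected_setX_teeth => //; try exact: connected_itv.
  + by apply: connected_setX; exact: connected_itv.
  + by exists (-2); split; rewrite /= in_itv /=; lra.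
- move=> [x y] [|[/= Sx]]; first by left; exact: subset_closure.
  rewrite in_itv /= => y1; have [y1'|y1'] := ltP (-1) y.
    by right; apply: subset_closure; split=> //=; rewrite in_itv /= y1'.
  left; rewrite closure_lower_left; split=> /=; rewrite in_itv //=.
  by move: (Sneg x Sx); rewrite /= in_itv => /ltW.
- rewrite -closureU; apply/closureS/setUS => -[x y] [Sx /=].
  rewrite !in_itv => /andP[_ y1].
  by split=> //=; rewrite in_itv.
Qed.

Lemma connected_lower_right :
  connected (closure lower_left `|` closure right_below)°.
Proof.
pose G : set (R * R) := setT `*` `]-oo, -1[ `|` right_below.
apply: (@connected_interior_dense _ G).
- apply: openU open_right_below.
  by apply: openX; [exact: openT|exact: interval_open].
- apply: connected_setX_teeth => //; try exact: connected_itv.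
  + by apply: connected_setX; [rewrite -set_itvNyy|]; exact: connected_itv.
  + by exists (-2); split; rewrite /= in_itv /=; lra.
- move=> [x y] [[_ /=]|]; last by right; exact: subset_closure.
  rewrite in_itv /= => y1; have [x0|x0] := leP x 0.
    by left; rewrite closure_lower_left; split=> /=; rewrite in_itv //= ltW.
  by right; apply: subset_closure; split=> /=; rewrite in_itv /= ?x0 //; lra.
- by rewrite -closureU; apply/closureS/setSU => -[x y] [].
Qed.

Lemma connected_right_strip : connected (closure right_strip)°.
Proof.
apply: (@connected_interior_dense _ right_strip) => //.
- exact/open_strip/interval_open.
- by apply: connected_setX; exact: connected_itv.
- exact: subset_closure.
Qed.

Lemma connected_strips S S' : `]-oo, 0[ `<=` closure S `|` closure S' ->
  connected (closure right_strip `|`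
    (closure (strip S) `|` closure (strip S')))°.
Proof.
move=> SS'; apply: (@connected_interior_dense _ (strip setT)).
- exact: open_strip openT.
- by apply: connected_setX; [rewrite -set_itvNyy|]; exact: connected_itv.
- move=> [x y] [_ y1]; rewrite !closureX; have cy := subset_closure y1.
  have [x0|x0] := leP 0 x.
    by left; split=> //=; rewrite closure_itvoy /= in_itv /= x0.
  have /SS'[Sx|Sx] : `]-oo, 0[%classic x by rewrite /= in_itv.
    by right; left.
  by right; right.
- by rewrite -!closureU; apply: closureS => -[x y] [[_ ?]|[[_ ?]|[_ ?]]].
Qed.

(* The axis consists of limits of points of the upper half-plane, of [strip S']
   and of the lower right quadrant, which avoid these regions. *)
Lemma lower_strip_interior_off_axis S S' y : open S' ->
  S `<=` `]-oo, 0[ -> S' `<=` `]-oo, 0[ -> S `<=` ~` S' -> closure S' 0 ->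
  ~ (closure lower_left `|` closure (strip S) `|` closure right_strip)° (0, y).
Proof.
move=> oS' Sneg S'neg SS' S'0; rewrite -!closureU; set X := _ `|` right_strip.
pose N : set (R * R) := upper `|` strip S' `|` `]0, +oo[ `*` `]-oo, -1[.
have oN : open N.
  apply: openU; last by apply: openX; exact: interval_open.
  by apply: openU; [exact: open_upper|exact: open_strip].
have NX : N `&` X = set0.
  rewrite -subset0 => -[a b] [Nab Xab]; move: Nab Xab.
  rewrite /N /X /upper /lower_left /right_strip /strip /= !in_itv /= !andbT.
  move=> [[[_ b1]|[S'a /andP[b1 b2]]]|[a1 b1]]
    [[[a2 b3]|[Sa /andP[b3 b4]]]|[a2 /andP[b3 b4]]]; try lra.
    by case: (SS' a Sa).
  by move: (S'neg a S'a); rewrite /= in_itv /=; lra.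
have /disjoints_subset XN : (closure X)° `&` closure N = set0.
  apply: open_disjoint_closure; first exact: open_interior.
  rewrite -subset0 -(open_disjoint_closure oN NX) => q [/interior_subset Xq Nq].
  by split.
move=> /XN; apply; rewrite !closureU.
have [y1|y1] := leP 1 y.
  by left; left; rewrite closure_upper; split=> //=; rewrite in_itv /= y1.
have [y2|y2] := leP y (-1).
  right; rewrite closureX closure_itvoy closure_itvNyo.
  by split; rewrite /= in_itv /= ?lexx.
left; right; rewrite closureX; split=> //=; apply: subset_closure.
by rewrite /= in_itv /= y1 y2.
Qed.

Lemma disconnected_lower_strip S S' : open S' ->
  S `<=` `]-oo, 0[ -> S' `<=` `]-oo, 0[ -> S `<=` ~` S' -> closure S' 0 ->
  ~ connected
      (closure lower_left `|` closure (strip S) `|` closure right_strip)°.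
Proof.
move=> oS' Sneg S'neg SS' S'0; set X := _ `|` closure right_strip => cX.
have sub A q : open A -> A `<=` X -> A q -> X° q.
  by move=> oA; rewrite (open_subsetE _ oA); exact.
have Xl : X° (-1, -2).
  apply: sub open_lower_left _ _; last by split; rewrite /= in_itv /=; lra.
  by apply: subset_trans (@subset_closure _ _) _ => ? ?; left; left.
have Xr : X° (1, 0).
  apply: (sub right_strip); first exact/open_strip/interval_open.
    by apply: subset_trans (@subset_closure _ _) _ => ? ?; right.
  by split; rewrite /= in_itv /=; lra.
have [||[x y] Xxy /= x0] :=
  @connected_ivt R _ fst X° (-1, -2) (1, 0) 0 _ cX Xl Xr.
- by move=> q; exact: cvg_fst.
- by rewrite /=; lra.
- by move: Xxy; rewrite x0; exact: lower_strip_interior_off_axis S'0.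
Qed.

Section Tiles.
Variables S0 S1 : set R.
Hypotheses (openS0 : open S0) (openS1 : open S1).
Hypotheses (S0neg : S0 `<=` `]-oo, 0[) (S1neg : S1 `<=` `]-oo, 0[).
Hypothesis S01 : S0 `<=` ~` S1.
Hypothesis S01cover : `]-oo, 0[ `<=` closure S0 `|` closure S1.
Hypotheses (S0acc : closure S0 0) (S1acc : closure S1 0).

Definition tile (i : 'I_3) : set (R * R) :=
  nth right_below [:: strip S0; strip S1] i.

Lemma tile_disjoint i j : i != j -> tile i `&` tile j = set0.
Proof.
have no01 q : strip S0 q -> strip S1 q -> False.
  by move=> [S0q _] [S1q _]; case: (S01 S0q).
have no_right S q : S `<=` `]-oo, 0[ -> strip S q -> right_below q -> False.
  move=> Sneg [/Sneg]; rewrite /right_below /= !in_itv /= andbT => q0 _ [].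
  by move: q0; lra.
move: i j; apply: ord3_ind; apply: ord3_ind => // _;
  rewrite -subset0 => q [qi qj].
- exact: no01 qi qj.
- exact: no_right qi qj.
- exact: no01 qj qi.
- exact: no_right qi qj.
- exact: no_right qj qi.
- exact: no_right qj qi.
Qed.

Lemma upper_tile_disjoint i j :
  i != j -> (upper `|` tile i) `&` (lower_left `|` tile j) = set0.
Proof.
move=> ij; have tile1 k q : tile k q -> q.2 < 1.
  move: k; apply: ord3_ind; rewrite /tile /strip /right_below /= !in_itv /=;
  by [case=> _ /andP[]|case].
have tile_lower k q : tile k q -> ~ lower_left q.
  move: k; apply: ord3_ind;
  rewrite /tile /strip /right_below /lower_left /= !in_itv /= ?andbT; lra.
rewrite -subset0 => q [[uq|qi] [lq|qj]].
- by move: uq lq; rewrite /upper /lower_left /= !in_itv /=; lra.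
- by move: uq; rewrite /upper /= in_itv /=; have := tile1 j q qj; lra.
- exact: tile_lower qi lq.
- by rewrite -(tile_disjoint ij).
Qed.

Lemma tiles_strip_configuration :
  strip_configuration (closure upper) (closure lower_left) (closure right_strip)
    (fun i => closure (tile i)).
Proof.
have neq0 (A : set (R * R)) q : A q -> closure A !=set0.
  by move=> Aq; exists q; exact: subset_closure.
split.
- by apply: (neq0 _ (0, 2)); split; rewrite //= in_itv /=; lra.
- by apply: (neq0 _ (-1, -2)); split; rewrite /= in_itv /=; lra.
- by apply: (neq0 _ (1, 0)); split; rewrite /= in_itv /=; lra.
- have [x [S0x _]] := S0acc filterT.
  by apply: (neq0 _ (x, 0)); split; rewrite //= in_itv /=; lra.
- apply: closureS => -[x y] [x0 /=]; rewrite in_itv => /andP[_ y1].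
  by split; rewrite //= in_itv.
- apply: ord3_ind; apply: connected_upperU => //; try exact: interval_open.
  + by rewrite bnd_simp; lra.
  + by rewrite bnd_simp; lra.
- apply: ord3_ind; [exact: connected_lower_strip|exact: connected_lower_strip|].
  exact: connected_lower_right.
- exact: connected_right_strip.
- exact: connected_strips.
- exact: disconnected_lower_strip S1acc.
- by apply: disconnected_lower_strip S0acc => //; exact: subsetCr.
- move=> i j ij; rewrite -!closureU.
  apply: rc_mul_closure_eq0; last exact: upper_tile_disjoint.
  apply: openU; first exact: open_upper.
  move: i {ij}; apply: ord3_ind; [exact: open_strip|exact: open_strip|].
  exact: open_right_below.
Qed.

End Tiles.

End Model.

Section Gaps.
Variable R : realType.

(* [harmonic n] is [(n + 1)^-1]. *)
Definition gap (n : nat) : set R := `]- harmonic n, - harmonic n.+1[.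
Definition even_gaps : set R := \bigcup_n gap n.*2.
Definition off_even_gaps : set R := `]-oo, 0[ `\` closure even_gaps.

Lemma open_gap n : open (gap n).
Proof. exact: interval_open. Qed.

Lemma gap_lt0 n : gap n `<=` `]-oo, 0[.
Proof.
move=> x; rewrite /gap /= !in_itv /= => /andP[_] /lt_trans; apply.
by rewrite oppr_lt0 invr_gt0.
Qed.

Lemma trivIset_gap : trivIset setT gap.
Proof.
apply/trivIsetP => i j _ _; wlog ij : i j / (i < j)%N => [W ij|_].
  have [lt|lt|/eqP] := ltngtP i j; last by rewrite (negbTE ij).
    exact: W.
  by rewrite setIC; apply: W; rewrite // eq_sym.
rewrite -subset0 => x []; rewrite /gap /= !in_itv /= => /andP[_ xi] /andP[jx _].
have := lt_trans jx xi.
by rewrite ltrN2 ltf_pV2 ?posrE // ltr_nat !ltnS leqNgt ij.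
Qed.

Lemma harmonic_ltS n : harmonic n.+1 < harmonic n :> R.
Proof. by rewrite /= ltf_pV2 ?posrE // ltr_nat. Qed.

Lemma closure_gaps0 (S : set R) :
  (forall N, exists2 n, (N <= n)%N & gap n `<=` S) -> closure S 0.
Proof.
move=> gapS B B0; pose u n : R := (- harmonic n + - harmonic n.+1) / 2.
have cvgu : u @ \oo --> (0 : R).
  rewrite -(mul0r 2^-1) -(addr0 0) -oppr0.
  apply: cvgMl; apply: cvgD; apply: cvgN; first exact: cvg_harmonic.
  by rewrite (cvg_shiftS (@harmonic R)); exact: cvg_harmonic.
have [N _ BN] := cvgu _ B0; have [n Nn nS] := gapS N.
exists (u n); split; last exact: BN.
have /= ltN : - harmonic n < - harmonic n.+1 :> R.
  by rewrite ltrN2; exact: harmonic_ltS.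
by apply: nS; rewrite /gap /u /= in_itv /= !midf_lt.
Qed.

Lemma open_even_gaps : open even_gaps.
Proof. by apply: bigcup_open => n _; exact: open_gap. Qed.

Lemma open_off_even_gaps : open off_even_gaps.
Proof.
apply: openI; first exact: interval_open.
by apply: closed_openC; exact: closed_closure.
Qed.

Lemma even_gaps_lt0 : even_gaps `<=` `]-oo, 0[.
Proof. by apply: bigcup_sub => n _; exact: gap_lt0. Qed.

Lemma odd_gap_off_even_gaps n : gap n.*2.+1 `<=` off_even_gaps.
Proof.
have off_closure : gap n.*2.+1 `&` closure even_gaps = set0.
  apply: open_disjoint_closure; first exact: open_gap.
  rewrite setI_bigcupr bigcup0 // => k _.
  move/trivIsetP: trivIset_gap; apply=> //.
  by apply/eqP => /(congr1 odd); rewrite /= !odd_double.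
move=> x nx; split; first exact: gap_lt0 nx.
by move: x nx; apply/disjoints_subset.
Qed.

Lemma gaps_strip_configuration :
  strip_configuration (closure (@upper R)) (closure (@lower_left R))
    (closure (@right_strip R))
    (fun i => closure (tile even_gaps off_even_gaps i)).
Proof.
apply: tiles_strip_configuration.
- exact: open_even_gaps.
- exact: open_off_even_gaps.
- exact: even_gaps_lt0.
- by move=> x [].
- by move=> x Ex [_]; apply; exact: subset_closure.
- move=> x x0; have [Ex|nEx] := pselect (closure even_gaps x); first by left.
  by right; exact: subset_closure.
- apply: closure_gaps0 => N; exists N.*2; first by rewrite -addnn leq_addr.
  by move=> x Nx; exists N.
- apply: closure_gaps0 => N; exists N.*2.+1; last exact: odd_gap_off_even_gaps.
  by rewrite -addnn leqW // leq_addr.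
Qed.

End Gaps.

Lemma strip_formula_satisfiable (R : realType) :
  satisfiable_over_RC (R * R)%type strip_formula.
Proof.
pose A n := nth set0 [:: strip (@even_gaps R); strip (@off_even_gaps R);
  @right_below R; @upper R; @lower_left R; @right_strip R] n.
exists (closure \o A); split.
  have oE := @open_even_gaps R; have oF := @open_off_even_gaps R.
  move=> n; apply: closure_open_regclosed; move: n.
  case=> [|[|[|[|[|[|n]]]]]]; rewrite /A /= ?nth_nil.
  - exact: open_strip.
  - exact: open_strip.
  - exact: open_right_below.
  - exact: open_upper.
  - exact: open_lower_left.
  - exact/open_strip/interval_open.
  - exact: open0.
apply/satisfies_strip_formula.
have := @gaps_strip_configuration R.
congr strip_configuration.
by apply/funext; apply: ord3_ind.
Qed.

Theorem theorem2 (R : realType) :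
  exists phi : formula,
    satisfiable_over_RC (R * R)%type phi /\
    ~ (exists I : nat -> set (R * R)%type,
         interpretation_over_RC I /\
         (forall n : nat, finitely_many_components (I n)) /\
         satisfies I phi).
Proof.
exists strip_formula; split; first exact: strip_formula_satisfiable.
move=> [I [IRC [finI /satisfies_strip_formula]]].
exact: no_finite_strip_configuration (IRC _) (IRC _) (IRC _) (fun=> IRC _)
  (fun _ _ => finI _).
Qed.
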